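(* There exists a $3$-way $6$-homogeneous $(v,3,2)$ Steiner trade of volume $2v$ for every $v\ge 13$, except possibly for $v\in\{17,19,20,22,23,25\}$.
   Context: Let $V$ be a finite set with $v$ elements and let $t<k<v$ be positive integers. A $\mu$-way $(v,k,t)$ trade $T=\{T_1,\dots,T_\mu\}$ of volume $m$ consists of $\mu$ pairwise disjoint collections $T_1,\dots,T_\mu$, each of $m$ blocks ($k$-subsets of $V$), such that every $t$-subset of $V$ is contained in the same number of blocks in each $T_i$. The foundation $\mathrm{found}(T)$ is the set of elements covered by the blocks. It is a Steiner trade if every $t$-subset of $\mathrm{found}(T)$ is in at most one block of each $T_i$, and $d$-homogeneous if every element of $V$ lies in exactly $d$ blocks of each $T_i$. *)

(* Defs.v *)
From mathcomp Require Import all_boot.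

Set Implicit Arguments.
Unset Strict Implicit.
Unset Printing Implicit Defensive.

Section Trades.

Variables (V : finType) (mu : nat).

Implicit Types (B : {set {set V}}) (S : {set V}) (T : 'I_mu -> {set {set V}}).

Definition blocks_containing B S : {set {set V}} := [set b in B | S \subset b].

(* A mu-way (#|V|, k, t) trade {T_1, ..., T_mu} of volume m, as an indexed
   family.  Collections are sets of blocks: for Steiner trades this loses
   nothing, since a repeated block would contain a t-subset covered twice. *)
Definition is_trade (k t m : nat) T : Prop :=
  [/\ 0 < t < k /\ k < #|V|,
      forall i j, i != j -> [disjoint T i & T j],
      forall i, #|T i| = m,
      forall i b, b \in T i -> #|b| = k
    & forall S, #|S| = t ->
        forall i j, #|blocks_containing (T i) S| = #|blocks_containing (T j) S|].

Definition found T : {set V} := \bigcup_i cover (T i).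

Definition steiner (t : nat) T : Prop :=
  forall S, S \subset found T -> #|S| = t ->
    forall i, #|blocks_containing (T i) S| <= 1.

Definition homogeneous (d : nat) T : Prop :=
  forall (x : V) i, #|[set b in T i | x \in b]| = d.

End Trades.

(* Main.v *)
Require Import Defs.
From mathcomp Require Import all_boot.

(** Trades on disjoint point sets can be added: on the union of the two point
    sets, the unions [T_i] of the corresponding collections again form a trade,
    because a pair of points meeting both sides lies in no block.  Hence the set
    of feasible [v] is closed under addition; it contains 13, 14, 15, 16, 18, 21
    and 24, by explicit constructions over cyclic groups, and these numbers
    generate every [v >= 13] outside the exceptional list. *)

Set Implicit Arguments.
Unset Strict Implicit.
Unset Printing Implicit Defensive.

(* The Steiner condition is required for all [t]-subsets, not only for those of
   the foundation; this is equivalent, the other ones being covered by no block. *)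
Definition trade_exists (mu k t d v m : nat) : Prop :=
  exists T : 'I_mu -> {set {set 'I_v}},
    [/\ is_trade k t m T,
        forall S : {set 'I_v}, #|S| = t ->
          forall i, #|blocks_containing (T i) S| <= 1
      & homogeneous d T].

(** * Subsets of an image *)

Lemma imset_subset_inj (aT rT : finType) (f : aT -> rT) (A B : {set aT}) :
  injective f -> (f @: A \subset f @: B) = (A \subset B).
Proof.
move=> injf; apply/idP/idP => [/subsetP sAB|]; last exact: imsetS.
apply/subsetP => x Ax; have := sAB _ (imset_f f Ax).
by rewrite mem_imset.
Qed.

Lemma sub_imsetP (aT rT : finType) (f : aT -> rT) (S : {set rT}) (A : {set aT}) :
  S \subset f @: A -> exists S' : {set aT}, S = f @: S'.
Proof.
move=> /subsetP sSA; exists (f @^-1: S); apply/setP => y; apply/idP/imsetP.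
  by move=> Sy; have /imsetP[x _ Ey] := sSA _ Sy; exists x; rewrite ?inE -?Ey.
by case=> x; rewrite inE => Sx ->.
Qed.

Lemma set_predT_in (T : finType) (A : {set T}) : [set x in A | predT x] = A.
Proof. by apply/setP => x; rewrite inE andbT. Qed.

(** * Blocks on a disjoint union of two point sets *)

Section DisjointUnion.

Variables (m n : nat).

Implicit Types (A : {set {set 'I_m}}) (B : {set {set 'I_n}}).
Implicit Types (a : {set 'I_m}) (b : {set 'I_n}) (S : {set 'I_(m + n)}).

Notation lsh := (@lshift m n).
Notation rsh := (@rshift m n).

Definition blocks_add A B : {set {set 'I_(m + n)}} :=
  [set lsh @: a | a : {set 'I_m} in A] :|: [set rsh @: b | b : {set 'I_n} in B].

Lemma lshift_imset_neq a b :
  a != set0 -> lsh @: a != rsh @: b.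
Proof.
case/set0Pn=> x ax; apply/eqP => E.
have: lsh x \in rsh @: b by rewrite -E imset_f.
by case/imsetP=> y _ /eqP; rewrite eq_lrshift.
Qed.

(** Only the empty block has the same image under both shifts; once it is excluded from [A], the two
    halves of the union are disjoint and their counts add. *)
Lemma card_blocks_add A B (P : pred {set 'I_(m + n)}) : set0 \notin A ->
  #|[set c in blocks_add A B | P c]| =
  #|[set a in A | P (lsh @: a)]| + #|[set b in B | P (rsh @: b)]|.
Proof.
move=> A0; have injl := imset_inj (@lshift_inj m n).
have injr := imset_inj (@rshift_inj m n).
rewrite -(card_imset _ injl) -(card_imset _ injr) -cardsUI.
have -> : [set lsh @: a | a : {set 'I_m} in [set a in A | P (lsh @: a)]] :&:
          [set rsh @: b | b : {set 'I_n} in [set b in B | P (rsh @: b)]] = set0.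
  apply/setP => c; rewrite !inE; apply/negP => /andP[].
  case/imsetP=> a; rewrite inE => /andP[aA _] ->.
  case/imsetP=> b _ /eqP; apply/negP/lshift_imset_neq.
  by apply: contraNneq A0 => <-.
rewrite cards0 addn0; apply: eq_card => c; rewrite !inE.
apply/andP/orP => [[/orP[] /imsetP[a aA ->] Pa]|[] /imsetP[a]].
- by left; apply/imsetP; exists a; rewrite // inE aA.
- by right; apply/imsetP; exists a; rewrite // inE aA.
- by rewrite inE => /andP[aA Pa] ->; rewrite imset_f.
- by rewrite inE => /andP[aA Pa] ->; rewrite imset_f ?orbT.
Qed.

Lemma card_blocks_containing_add A B S : set0 \notin A ->
  #|blocks_containing (blocks_add A B) S| =
  #|[set a in A | S \subset lsh @: a]| + #|[set b in B | S \subset rsh @: b]|.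
Proof. exact: card_blocks_add. Qed.

Lemma lshift_subset_rshift (S : {set 'I_m}) b :
  S != set0 -> (lsh @: S \subset rsh @: b) = false.
Proof.
case/set0Pn=> x Sx; apply/negP => /subsetP/(_ _ (imset_f _ Sx)).
by case/imsetP=> y _ /eqP; rewrite eq_lrshift.
Qed.

Lemma rshift_subset_lshift (S : {set 'I_n}) a :
  S != set0 -> (rsh @: S \subset lsh @: a) = false.
Proof.
case/set0Pn=> x Sx; apply/negP => /subsetP/(_ _ (imset_f _ Sx)).
by case/imsetP=> y _ /eqP; rewrite eq_rlshift.
Qed.

(** The case and [S'] depend on [S] alone, not on [A] and [B]: one case distinction thus serves all
    the collections of a trade, which balance compares with each other. *)
Lemma blocks_containing_add_cases S : S != set0 ->
  [\/ exists2 S' : {set 'I_m}, #|S'| = #|S| &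
        forall A B, set0 \notin A ->
          #|blocks_containing (blocks_add A B) S| = #|blocks_containing A S'|,
      exists2 S' : {set 'I_n}, #|S'| = #|S| &
        forall A B, set0 \notin A ->
          #|blocks_containing (blocks_add A B) S| = #|blocks_containing B S'|
    | forall A B, set0 \notin A ->
        #|blocks_containing (blocks_add A B) S| = 0].
Proof.
move=> S0.
case: (boolP (S \subset lsh @: setT)) => [/sub_imsetP[S' ES]|SL].
  constructor 1; exists S'; first by rewrite ES card_imset //; exact: lshift_inj.
  move=> A B A0; rewrite card_blocks_containing_add // ES.
  have S'0 : S' != set0 by apply: contraNneq S0 => S'0; rewrite ES S'0 imset0.
  rewrite [X in _ + X]eq_card0 ?addn0 => [|b]; last first.
    by rewrite inE lshift_subset_rshift // andbF.
  by apply: eq_card => a; rewrite !inE imset_subset_inj //; exact: lshift_inj.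
case: (boolP (S \subset rsh @: setT)) => [/sub_imsetP[S' ES]|SR].
  constructor 2; exists S'; first by rewrite ES card_imset //; exact: rshift_inj.
  move=> A B A0; rewrite card_blocks_containing_add // ES.
  have S'0 : S' != set0 by apply: contraNneq S0 => S'0; rewrite ES S'0 imset0.
  rewrite [X in X + _]eq_card0 ?add0n => [|b]; last first.
    by rewrite inE rshift_subset_lshift // andbF.
  by apply: eq_card => a; rewrite !inE imset_subset_inj //; exact: rshift_inj.
constructor 3 => A B A0; rewrite card_blocks_containing_add // !eq_card0 // => b;
  rewrite inE; apply/negP => /andP[_ Sb].
  by case/negP: SR; apply: subset_trans Sb (imsetS _ (subsetT _)).
by case/negP: SL; apply: subset_trans Sb (imsetS _ (subsetT _)).
Qed.

End DisjointUnion.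

Lemma trade_existsD (mu k t d v1 v2 m1 m2 : nat) :
  trade_exists mu k t d v1 m1 -> trade_exists mu k t d v2 m2 ->
  trade_exists mu k t d (v1 + v2) (m1 + m2).
Proof.
case=> T1 [[[tk kv1] dis1 vol1 blk1 bal1] st1 hom1].
case=> T2 [[[_ kv2] dis2 vol2 blk2 bal2] st2 hom2].
have [t0 ltk] := andP tk; have k0 : 0 < k := ltn_trans t0 ltk.
have T10 i : set0 \notin T1 i.
  by apply/negP => /blk1; rewrite cards0 => k00; rewrite -k00 in k0.
exists (fun i => blocks_add (T1 i) (T2 i)); split; first split.
- by split=> //; move: kv1 kv2; rewrite !card_ord => kv1 _; apply: ltn_addr.
- move=> i j nij; rewrite disjoints_subset; apply/subsetP => c; rewrite !inE.
  have neq (a : {set 'I_v1}) (b : {set 'I_v2}) : a \in T1 i \/ a \in T1 j ->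
      @lshift v1 v2 @: a <> @rshift v1 v2 @: b.
    move=> aT; apply/eqP/lshift_imset_neq; apply/eqP => a0; rewrite a0 in aT.
    by case: aT; apply/negP.
  case/orP=> /imsetP[a aT ->]; rewrite negb_or; apply/andP; split;
    apply/negP => /imsetP[b bT E].
  + have Eab := imset_inj (@lshift_inj v1 v2) E; rewrite -Eab in bT.
    by rewrite (disjointFr (dis1 _ _ nij) aT) in bT.
  + by case: (neq a b _ E); left.
  + by case: (neq b a _ (esym E)); right.
  + have Eab := imset_inj (@rshift_inj v1 v2) E; rewrite -Eab in bT.
    by rewrite (disjointFr (dis2 _ _ nij) aT) in bT.
- move=> i; have := @card_blocks_add v1 v2 (T1 i) (T2 i) predT (T10 i).
  by rewrite !set_predT_in vol1 vol2.
- move=> i b; rewrite inE => /orP[] /imsetP[a aT ->]; rewrite card_imset.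
  + exact: blk1 aT.
  + exact: lshift_inj.
  + exact: blk2 aT.
  + exact: rshift_inj.
- move=> S cS i j; have S0 : S != set0 by rewrite -card_gt0 cS.
  have [[S' cS' E]|[S' cS' E]|E] := blocks_containing_add_cases S0; rewrite !E //.
  + by apply: bal1; rewrite cS'.
  + by apply: bal2; rewrite cS'.
- move=> S cS i; have S0 : S != set0 by rewrite -card_gt0 cS.
  have [[S' cS' E]|[S' cS' E]|E] := blocks_containing_add_cases S0; rewrite E //.
  + by apply: st1; rewrite cS'.
  + by apply: st2; rewrite cS'.
- move=> x i; rewrite card_blocks_add //; case: (split_ordP x) => y ->.
  + rewrite [X in _ + X]eq_card0 ?addn0 => [|b]; last first.
      rewrite !inE; apply/negP => /andP[_] /imsetP[z _ /eqP].
      by rewrite eq_lrshift.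
    rewrite -(hom1 y i); apply: eq_card => a; rewrite !inE mem_imset //.
    exact: lshift_inj.
  + rewrite [X in X + _]eq_card0 ?add0n => [|b]; last first.
      rewrite !inE; apply/negP => /andP[_] /imsetP[z _ /eqP].
      by rewrite eq_rlshift.
    rewrite -(hom2 y i); apply: eq_card => a; rewrite !inE mem_imset //.
    exact: rshift_inj.
Qed.

(** * Verification of explicit trades by computation *)

Section Explicit.

Variable n : nat.

Implicit Types (b : seq nat) (L : seq (seq nat)).

Definition block_set b : {set 'I_n} := [set x | val x \in b].

(** A computable normal form: the increasing list of the points, so that blocks are compared as
    sets. *)
Definition canon b : seq nat := [seq x <- iota 0 n | x \in b].

Lemma canonE b : canon b = [seq val x | x <- enum (block_set b)].
Proof.
rewrite /canon -val_enum_ord filter_map /enum_mem; congr map.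
by rewrite -filter_predI; apply: eq_filter => x /=; rewrite !inE andbT.
Qed.

Lemma card_block_set b : #|block_set b| = size (canon b).
Proof. by rewrite canonE size_map cardE. Qed.

(** [canon] factors through [block_set], so different normal forms come from different sets. *)
Lemma uniq_block_set L : uniq (map canon L) -> uniq (map block_set L).
Proof.
rewrite (eq_map canonE) (map_comp (fun s : {set 'I_n} => map val (enum s))).
exact: map_uniq.
Qed.

Lemma card_block_sets L (P : pred {set 'I_n}) : uniq (map canon L) ->
  #|[set s in [set:: map block_set L] | P s]| = count (P \o block_set) L.
Proof.
move=> /uniq_block_set uL; rewrite -count_map -size_filter.
rewrite -(card_uniqP (filter_uniq P uL)); apply: eq_card => s.
by rewrite !inE mem_filter andbC.
Qed.

(** Comparing each [c i] with [c 0], itself at most 1, tests balance and the Steiner condition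
    together. *)
Definition trade_check (mu d m : nat) (F : nat -> seq (seq nat)) : bool :=
  [&& all (fun i => [&& uniq (map canon (F i)), size (F i) == m,
        all (fun b => size (canon b) == 3) (F i)
      & all (fun x => count (fun b => x \in b) (F i) == d) (iota 0 n)])
        (iota 0 mu),
      all (fun i => all (fun j => (i != j) ==>
        ~~ has (mem (map canon (F i))) (map canon (F j))) (iota 0 mu)) (iota 0 mu)
    & all (fun x => all (fun y => (x != y) ==>
        let c i := count (fun b => (x \in b) && (y \in b)) (F i) in
        (c 0 <= 1) && all (fun i => c i == c 0) (iota 0 mu))
        (iota 0 n)) (iota 0 n)].

Lemma trade_checkP (mu d m : nat) (F : nat -> seq (seq nat)) :
  3 < n -> trade_check mu d m F -> trade_exists mu 3 2 d n m.
Proof.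
move=> n3 /and3P[/allP chk /allP dis /allP bal].
have memi (p : nat) (i : 'I_p) : val i \in iota 0 p by rewrite mem_iota ltn_ord.
have {}chk (i : 'I_mu) := and4P (chk i (memi _ i)).
have pair (S : {set 'I_n}) (cS : #|S| = 2) : exists c0, (c0 <= 1) /\ forall i : 'I_mu,
    #|blocks_containing [set:: map block_set (F i)] S| = c0.
  have /cards2P[x [y [nxy ->]]] : #|S| == 2 by rewrite cS.
  have /allP/(_ _ (memi _ y))/implyP/(_ nxy) := bal _ (memi _ x).
  set c := fun i : nat => _; case/andP=> c1 /allP ci; exists (c 0); split=> // i.
  rewrite -(eqP (ci _ (memi _ i))) card_block_sets; last by case: (chk i).
  by apply: eq_count => b /=; rewrite subUset !sub1set !inE.
exists (fun i => [set:: map block_set (F i)]); split; first split.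
- by rewrite card_ord.
- move=> i j nij; rewrite disjoints_subset; apply/subsetP => s; rewrite !inE.
  case/mapP=> b bF ->; apply/negP => /mapP[b' b'F E].
  have /allP/(_ _ (memi _ j))/implyP/(_ nij)/hasPn := dis _ (memi _ i).
  move=> /(_ _ (map_f _ b'F)) /negP[]; rewrite /= canonE -E -canonE.
  exact: map_f.
- move=> i; have [u /eqP <- _ _] := chk i; have := card_block_sets predT u.
  by rewrite set_predT_in count_predT.
- move=> i s; rewrite inE => /mapP[b bF ->]; have [_ _ /allP c3 _] := chk i.
  by rewrite card_block_set; apply/eqP/c3.
- by move=> S /pair[c [_ E]] i j; rewrite !E.
- by move=> S /pair[c [c1 E]] i; rewrite E.
- move=> x i; have [u _ _ /allP/(_ _ (memi _ x))/eqP <-] := chk i.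
  by rewrite card_block_sets //; apply: eq_count => b /=; rewrite inE.
Qed.

End Explicit.

(** * Trades developed from base blocks modulo [n] *)

Definition develop (n s : nat) (B : seq (seq nat)) : seq (seq nat) :=
  [seq [seq (x + j * s) %% n | x <- b] | j <- iota 0 (n %/ s), b <- B].

Definition iter_blocks (p : nat -> nat) (L : seq (seq nat)) (i : nat) :=
  map (map (iter i p)) L.

(* Multiplication by 9, 8, 10 on the three cosets of the subgroup of order 4 of
   the multiplicative group modulo 13. *)
Definition perm13 (x : nat) : nat :=
  (if x \in [:: 1; 5; 8; 12] then 9 else if x \in [:: 2; 3; 10; 11] then 8 else 10)
  * x %% 13.

(* A cyclic STS(13) and two isomorphic copies. *)
Lemma trade_exists13 : trade_exists 3 3 2 6 13 26.
Proof.
apply: (@trade_checkP _ _ _ _ (iter_blocks perm13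
  (develop 13 1 [:: [:: 0; 1; 4]; [:: 0; 2; 7]]))); first by [].
by vm_compute.
Qed.

(** Three group divisible designs of type 2^7 with groups [{x, x + 7}], each made of four orbits of
    length 7 under the even translations. *)
Lemma trade_exists14 : trade_exists 3 3 2 6 14 28.
Proof.
apply: (@trade_checkP _ _ _ _ (fun i => develop 14 2 (nth [::]
  [:: [:: [:: 0; 1; 2]; [:: 0; 3; 6]; [:: 0; 4; 9]; [:: 1; 3; 7]];
      [:: [:: 0; 1; 3]; [:: 0; 2; 6]; [:: 0; 5; 11]; [:: 0; 9; 13]];
      [:: [:: 0; 1; 5]; [:: 0; 2; 10]; [:: 0; 3; 9]; [:: 0; 11; 13]]] i))); first by [].
by vm_compute.
Qed.

(* The permutation preserves the five classes modulo 5, the groups of the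
   group divisible design of type 3^5 developed from the base blocks. *)
Lemma trade_exists15 : trade_exists 3 3 2 6 15 30.
Proof.
apply: (@trade_checkP _ _ _ _
  (iter_blocks (fun x => (x + 5 * (x %% 5)./2) %% 15)
     (develop 15 1 [:: [:: 0; 1; 4]; [:: 0; 2; 8]]))); first by [].
by vm_compute.
Qed.

(* With [a = 1], [b = 3], [e = a + h], [f = b + h], where [2 h = n]: the
   differences [a, b, e, f, a + b, a - b] split into zero-sum triples in two
   ways, since [e + f = a + b] and [e - f = a - b] modulo [n].  The splitting
   {a, b, a + b}, {e, f, e - f} gives two cyclic families, according to the
   orientation of the triples, and {a, b, a - b}, {e, f, e + f} the third. *)
Definition even_trade (h i : nat) : seq (seq nat) :=
  develop h.*2 1 (nth [::]
    [:: [:: [:: 0; 1; 4]; [:: 0; h.+1; h.*2 - 2]];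
        [:: [:: 0; 3; 4]; [:: 0; h - 3; h.*2 - 2]];
        [:: [:: 0; 1; h.*2 - 2]; [:: 0; h.+1; 4]]] i).

(** Up to sign the six differences are 1, 2, 3, 4, 5, 7, distinct modulo 16. *)
Lemma trade_exists16 : trade_exists 3 3 2 6 16 32.
Proof. by apply: (@trade_checkP _ _ _ _ (even_trade 8)); vm_compute. Qed.

Lemma trade_exists18 : trade_exists 3 3 2 6 18 36.
Proof. by apply: (@trade_checkP _ _ _ _ (even_trade 9)); vm_compute. Qed.

(* Three mutually orthogonal Latin squares of order 7 with their common
   transversal removed; the points are [3 x + g] with [x] modulo 7 and [g < 3]. *)
Lemma trade_exists21 : trade_exists 3 3 2 6 21 42.
Proof.
apply: (@trade_checkP _ _ _ _ (fun i => develop 21 3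
  [seq [:: 0; 3 * x + 1; 3 * (i.+2 * x) + 2] | x <- iota 1 6])); first by [].
by vm_compute.
Qed.

Lemma trade_exists24 : trade_exists 3 3 2 6 24 48.
Proof. by apply: (@trade_checkP _ _ _ _ (even_trade 12)); vm_compute. Qed.

(** * Generation of all admissible [v] by sums *)

Lemma trade_exists_all (v : nat) : 13 <= v ->
  v \notin [:: 17; 19; 20; 22; 23; 25] -> trade_exists 3 3 2 6 v (2 * v).
Proof.
have add x y : trade_exists 3 3 2 6 x (2 * x) ->
    trade_exists 3 3 2 6 y (2 * y) -> trade_exists 3 3 2 6 (x + y) (2 * (x + y)).
  by rewrite mulnDr; exact: trade_existsD.
have t13 := trade_exists13; have t14 := trade_exists14; have t15 := trade_exists15.
have t16 := trade_exists16; have t18 := trade_exists18; have t21 := trade_exists21.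
have t24 := trade_exists24; elim/ltn_ind: v => v IH v13 vexc.
have [v39|v39] := leqP 39 v.
  (* From 39 on, [v - 13] lies beyond 25, the largest exception. *)
  have v13' : 26 <= v - 13 by rewrite leq_subRL.
  rewrite -(subnKC v13); apply: (add 13) => //; apply: IH.
  - by rewrite ltn_subrL (leq_trans _ v13).
  - exact: leq_trans v13'.
  - by rewrite !inE !gtn_eqF // (leq_trans _ v13').
(* The generators and the exceptions are closed at once; the values 26 to 38 remain, in this
   order. *)
move: v vexc v13 v39 {IH}; do 39 ?[case=> //] => _ _ _.
- exact: (add 13 13).
- exact: (add 13 14).
- exact: (add 14 14).
- exact: (add 13 16).
- exact: (add 14 16).
- exact: (add 15 16).
- exact: (add 16 16).
- exact: (add 15 18).
- exact: (add 16 18).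
- exact: (add 14 21).
- exact: (add 18 18).
- exact: (add 13 24).
- exact: (add 14 24).
Qed.

Theorem theorem3p6 (v : nat) (hv : 13 <= v)
    (hexc : v \notin [:: 17; 19; 20; 22; 23; 25]) :
  exists T : 'I_3 -> {set {set 'I_v}},
    [/\ is_trade 3 2 (2 * v) T, steiner 2 T & homogeneous 6 T].
Proof.
have [T [trT stT homT]] := trade_exists_all hv hexc.
by exists T; split=> // S _; exact: stT.
Qed.
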